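(* Let $d\geq 6$ and $k>1$ be integers. There does not exist any $(d,k)$-digraph with self-repeats if either $k$ is odd and $k\geq 2(d-1)$, or $k$ is even and $k\geq 2(d-1)^2$.
   Context: All digraphs are finite, without loops or multiple arcs. A digraph is diregular of degree $d$ if every vertex has in-degree and out-degree $d$. A $(d,k)$-digraph (almost Moore digraph) is a diregular digraph of degree $d>1$, diameter $k>1$ and order $N=d+d^2+\cdots+d^k$. In such a digraph every vertex $v$ has a unique vertex $r(v)$, called the repeat of $v$, such that there are exactly two walks of length $\leq k$ from $v$ to $r(v)$, at least one of them of length $k$. A vertex $v$ is a self-repeat if $r(v)=v$; the digraph ''has self-repeats'' if it has at least one self-repeat. *)

(* Defs.v *)
From mathcomp Require Import all_boot.

Set Implicit Arguments.
Unset Strict Implicit.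
Unset Printing Implicit Defensive.

(* A digraph on a finite vertex set T is its adjacency relation e : rel T;
   multiple arcs are excluded by this encoding, loops by [irreflexive e]. *)

Section Digraph.
Variables (T : finType) (e : rel T).

(* A walk of length l starting at u is given by its l vertices after u. *)
Definition walk (u v : T) (l : nat) (p : l.-tuple T) : bool :=
  path e u p && (last u p == v).

Definition num_walks (l : nat) (u v : T) : nat :=
  #|[set p : l.-tuple T | walk u v p]|.

Definition outdeg (u : T) : nat := #|[set v | e u v]|.
Definition indeg (u : T) : nat := #|[set v | e v u]|.

Definition diregular (d : nat) : Prop :=
  forall u, outdeg u = d /\ indeg u = d.

Definition is_dist (u v : T) (l : nat) : Prop :=
  (exists p : l.-tuple T, walk u v p) /\
  (forall m (p : m.-tuple T), walk u v p -> l <= m).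

Definition has_diameter (k : nat) : Prop :=
  (forall u v, exists2 l, is_dist u v l & l <= k) /\
  (exists u v, is_dist u v k).

Definition almost_moore (d k : nat) : Prop :=
  [/\ 1 < d /\ 1 < k, irreflexive e, diregular d, has_diameter k
    & #|T| = \sum_(1 <= i < k.+1) d ^ i].

(* [is_repeat k v w] says that w = r(v). The trivial walk of length 0 is
   counted, so v is its own repeat when exactly one closed walk of positive
   length <= k passes through v, and that walk has length k. *)
Definition is_repeat (k : nat) (v w : T) : Prop :=
  \sum_(0 <= l < k.+1) num_walks l v w = 2 /\ 0 < num_walks k v w.

Definition self_repeat (k : nat) (v : T) : Prop := is_repeat k v v.

Definition has_self_repeats (k : nat) : Prop := exists v, self_repeat k v.

End Digraph.

(* Main.v *)
Require Import Defs.
From mathcomp Require Import all_boot all_algebra.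
From mathcomp Require Import zify.

(** Let A be the adjacency matrix. Counting gives I + A + ... + A^k = J + P,
    where P is the permutation matrix of the repeat map r, an automorphism.
    Let z be a self-repeat. For every p, the vertices fixed by r^p induce a
    digraph that is regular of some degree c and has c + ... + c^k vertices.
    Its quotient by r has an adjacency matrix M with traces tau_l = tr M^l
    such that tau_l - c^l is periodic in l with period k; since
    tr M^(q l) = tr M^l mod q for every prime q, this difference depends only
    on gcd(l, k). If l < k and l p <= k then tau_l = 0, for otherwise some
    vertex would lie on a closed walk that is too short. Hence c > 1 forces
    every such l to divide k.
    For p = 1 and l = k - 1 this gives c = 1, so z has an out-neighbour that
    is not fixed by r; let p <= d - 1 be its period, so that c > 1 for this p.
    When k is odd, l = 2 gives a contradiction; when k is even, L = k %/ p and
    L - 1 both divide k, whence L (L - 1) <= k, which is too large. *)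

Set Implicit Arguments.
Unset Strict Implicit.
Unset Printing Implicit Defensive.

Import GRing.Theory.

(** * Traces of prime powers of matrices *)

Section FrobeniusTrace.
Local Open Scope ring_scope.

Lemma map_mx_exp (R S : nzRingType) (f : {rmorphism R -> S}) n
    (M : 'M[R]_n.+1) m : map_mx f (M ^+ m) = (map_mx f M) ^+ m.
Proof.
elim: m => [|m IH]; first by rewrite !expr0 map_mx1.
by rewrite !exprS -IH map_mxM.
Qed.

Lemma det_exp (R : comNzRingType) n (M : 'M[R]_n.+1) m :
  \det (M ^+ m) = (\det M) ^+ m.
Proof.
elim: m => [|m IH]; first by rewrite !expr0 det1.
by rewrite !exprS det_mulmx IH.
Qed.

Variables (F : fieldType) (q : nat).
Hypotheses (qF : q \in [pchar F]) (expF : forall x : F, x ^+ q = x).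

Lemma poly_exp_pchar_comp (f : {poly F}) : f ^+ q = f \Po 'X^q.
Proof.
have qP : q \in [pchar {poly F}] by rewrite pchar_poly.
rewrite -{1}[f]coefK poly_def comp_polyE.
rewrite -(pFrobenius_autE qP) rmorph_sum /=.
apply: eq_bigr => i _.
by rewrite pFrobenius_autE exprZn -!exprM mulnC expF.
Qed.

(** In characteristic [q] the commuting terms give [(X - M)^q = X^q - M^q]. Determinants turn this
    into equality of the two characteristic polynomials after the injective substitution of [X^q]
    for [X]. *)
Lemma char_poly_exp_pchar n (M : 'M[F]_n.+1) : char_poly (M ^+ q) = char_poly M.
Proof.
have q_gt0 : (0 < q)%N by rewrite prime_gt0 // (pcharf_prime qF).
have qP : q \in [pchar 'M[{poly F}]_n.+1].
  rewrite inE (pcharf_prime qF) /= -(rmorph_nat (@scalar_mx _ n.+1)).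
  by rewrite -(rmorph_nat (@polyC F)) (pcharf0 qF) !rmorph0.
have E : (char_poly_mx M) ^+ q =
    map_mx (comp_poly 'X^q) (char_poly_mx (M ^+ q)).
  rewrite /char_poly_mx -(pFrobenius_autE qP) pFrobenius_autB_comm; last first.
    exact: comm_scalar_mx.
  rewrite !pFrobenius_autE map_mxB map_scalar_mx /= comp_polyX.
  rewrite -rmorphXn -(map_mx_exp (@polyC F)) /=; congr (_ - _).
  by apply/matrixP => i j; rewrite !mxE comp_polyC.
have D : char_poly M \Po 'X^q = char_poly (M ^+ q) \Po 'X^q.
  by rewrite -poly_exp_pchar_comp /char_poly -det_map_mx -E det_exp.
apply/polyP => i; move/polyP/(_ (i * q)%N): D.
by rewrite !coef_comp_poly_Xn // dvdn_mull // mulnK.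
Qed.

Lemma trace_exp_pchar n (M : 'M[F]_n.+1) : \tr (M ^+ q) = \tr M.
Proof.
by apply: oppr_inj; rewrite -!char_poly_trace // char_poly_exp_pchar.
Qed.
End FrobeniusTrace.

Lemma natr_Fp_eqmod q (a b : nat) : prime q ->
  (a%:R = b%:R :> 'F_q)%R <-> a = b %[mod q].
Proof.
move=> q_pr; split=> [ab | ab]; first by rewrite -!val_Fp_nat // ab.
by rewrite -(Fp_nat_mod q_pr a) ab Fp_nat_mod.
Qed.

Lemma Fp_expr_prime q (x : 'F_q) : prime q -> (x ^+ q = x)%R.
Proof.
move=> q_pr; rewrite -[x]natr_Zp -natrX; apply/natr_Fp_eqmod => //.
exact: fermat_little.
Qed.

(** * Powers of kernels on a finite type *)

Section Kernel.
Variable T : finType.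
Implicit Types g : T -> T -> nat.

Fixpoint kpow g (l : nat) (u v : T) : nat :=
  if l is m.+1 then \sum_w g u w * kpow g m w v else u == v.

Lemma sum_delta (F : T -> nat) x : \sum_w F w * (w == x) = F x.
Proof.
rewrite (bigD1 x) //= eqxx muln1 big1 ?addn0 // => w /negPf->.
by rewrite muln0.
Qed.

Lemma sum_deltal (F : T -> nat) x : \sum_w (x == w) * F w = F x.
Proof.
by rewrite -[RHS]sum_delta; apply: eq_bigr => w _; rewrite mulnC eq_sym.
Qed.

Lemma kpow1 g u v : kpow g 1 u v = g u v.
Proof. exact: sum_delta. Qed.

Lemma kpowD g l m u v : kpow g (l + m) u v = \sum_w kpow g l u w * kpow g m w v.
Proof.
elim: l u => [|l IH] u /=; first by rewrite sum_deltal.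
under eq_bigr => w _ do rewrite IH big_distrr.
rewrite exchange_big /=; apply: eq_bigr => w _.
by rewrite big_distrl /=; apply: eq_bigr => x _; rewrite mulnA.
Qed.

Lemma kpowSr g l u v : kpow g l.+1 u v = \sum_w kpow g l u w * g w v.
Proof. by rewrite -addn1 kpowD; under eq_bigr do rewrite kpow1. Qed.

Lemma kpow_kpow g l m : kpow (kpow g l) m =2 kpow g (m * l).
Proof.
elim: m => [|m IH] u v //=.
by rewrite mulSn kpowD; apply: eq_bigr => w _; rewrite IH.
Qed.

Lemma kpow_gt0D g l m u w v :
  0 < kpow g l u w -> 0 < kpow g m w v -> 0 < kpow g (l + m) u v.
Proof.
by move=> lw mw; rewrite kpowD (bigD1 w) //= ltn_addr // muln_gt0 lw.
Qed.

Lemma leq_kpow g g' : (forall u v, g u v <= g' u v) ->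
  forall l u v, kpow g l u v <= kpow g' l u v.
Proof.
move=> gg'; elim=> [|l IH] u v //=.
by apply: leq_sum => w _; apply: leq_mul.
Qed.

Lemma kpow_row_sum (X : pred T) g c :
  (forall u v, ~~ X v -> g u v = 0) ->
  (forall u, X u -> \sum_(v | X v) g u v = c) ->
  forall l u, X u -> \sum_(v | X v) kpow g l u v = c ^ l.
Proof.
move=> gX rc; elim=> [|l IH] u Xu /=.
  rewrite (bigD1 u) //= eqxx big1 ?addn0 // => v /andP[_ /negPf].
  by rewrite eq_sym => ->.
rewrite exchange_big /= (bigID X) /= [X in _ + X]big1 ?addn0; last first.
  by move=> w Xw; rewrite big1 // => v _; rewrite gX.
rewrite expnS -(rc _ Xu) big_distrl /=; apply: eq_bigr => w Xw.
by rewrite -big_distrr /= IH // rc.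
Qed.

Lemma kpow_morph g (f : T -> T) : bijective f ->
  (forall u v, g (f u) (f v) = g u v) ->
  forall l u v, kpow g l (f u) (f v) = kpow g l u v.
Proof.
move=> bf gf; elim=> [|l IH] u v /=; first by rewrite (bij_eq bf).
rewrite (reindex f) /=; last exact: onW_bij.
by apply: eq_bigr => w _; rewrite gf IH.
Qed.

Lemma trace_kpow_prime g q l : prime q ->
  \sum_u kpow g (q * l) u u = \sum_u kpow g l u u %[mod q].
Proof.
(* Square matrices form a ring here only in sizes [n.+1], so the empty type is set aside. *)
move=> q_pr; case: (posnP #|T|) => [T0 | Tgt0].
  by rewrite !big1 // => u; move: (fintype0 u T0).
have En : #|T|.-1.+1 = #|T| by rewrite prednK.
set f : 'I_#|T|.-1.+1 -> T := fun i => enum_val (cast_ord En i).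
have bf : bijective f.
  exists (fun x => cast_ord (esym En) (enum_rank x)) => x.
    by rewrite /f enum_valK cast_ordK.
  by rewrite /f cast_ordKV enum_rankK.
pose M h : 'M['F_q]_#|T|.-1.+1 := (\matrix_(i, j) (h (f i) (f j))%:R)%R.
have ME h m : ((M h) ^+ m)%R = M (kpow h m).
  elim: m => [|m IH].
    apply/matrixP => i j.
    by rewrite expr0 !mxE /= (bij_eq bf).
  apply/matrixP => i j; rewrite exprS IH !mxE /= (reindex f) /=; last exact: onW_bij.
  by rewrite natr_sum; apply: eq_bigr => x _; rewrite !mxE natrM.
have trM h : (\tr (M h) = (\sum_u h u u)%:R)%R.
  rewrite (reindex f) /=; last exact: onW_bij.
  by rewrite natr_sum; apply: eq_bigr => x _; rewrite !mxE.
apply/(natr_Fp_eqmod _ _ q_pr).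
under eq_bigr do rewrite -kpow_kpow.
rewrite -!trM -ME trace_exp_pchar ?pchar_Fp // => x; exact: Fp_expr_prime.
Qed.
End Kernel.

(** * Periodic sequences with Frobenius congruences *)

Section PeriodicCongruence.
Variables (u : nat -> int) (k : nat).
Hypotheses (k_gt0 : 0 < k)
  (uP : forall m, 0 < m -> u (m + k)%N = u m)
  (uq : forall q m, prime q -> 0 < m -> (q%:Z %| (u (q * m)%N - u m)%R)%Z).

Lemma periodic_bounded : exists B, forall m, (0 < m)%N -> (absz (u m) <= B)%N.
Proof.
exists (\max_(i < k.+1) absz (u i)) => m.
elim/ltn_ind: m => m IH m_gt0; case: (leqP m k) => [mk | km].
  exact: (@leq_bigmax _ (fun i : 'I_k.+1 => absz (u i)) (Ordinal (mk : m < k.+1))).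
by rewrite -(subnK (ltnW km)) uP ?subn_gt0 //; apply: IH; lia.
Qed.

Lemma periodic_muln m t : 0 < m -> u (m + k * t)%N = u m.
Proof.
move=> m0; elim: t => [|t IH]; first by rewrite muln0 addn0.
by rewrite mulnS addnCA [k + _]addnC uP ?IH // addn_gt0 m0.
Qed.

(** Prime factors of [s] are removed one at a time: the two values are congruent mod [q] and differ
    by at most [2 * B < q], so they coincide. *)
Lemma periodic_rough B s m : (forall i, 0 < i -> absz (u i) <= B)%N ->
  (0 < m)%N -> (0 < s)%N -> (forall q, prime q -> q %| s -> 2 * B < q)%N ->
  u (s * m)%N = u m.
Proof.
move=> uB m0; elim/ltn_ind: s => s IH s0 sq.
case: (ltngtP s 1) => [||->]; [lia | move=> s1 | by rewrite mul1n].
have q_pr := pdiv_prime s1; set q := pdiv s in q_pr.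
have /dvdnP[t st] : (q %| s)%N := pdiv_dvd s.
have q1 := prime_gt1 q_pr.
have t0 : (0 < t)%N by lia.
have E : u (t * m)%N = u m.
  apply: IH => //; first by rewrite st ltn_Pmulr.
  by move=> q' q'_pr q't; apply: sq => //; rewrite st dvdn_mulr.
rewrite -E st (mulnC t) -mulnA.
have tm0 : (0 < t * m)%N by rewrite muln_gt0 t0.
have qB : (2 * B < q)%N by apply: sq => //; rewrite st dvdn_mull.
have := uq q_pr tm0; have := uB _ tm0.
have : (0 < q * (t * m))%N by rewrite muln_gt0 tm0 prime_gt0.
move/uB; move: (u _) (u _) => x y xB yB /dvdzP[z xyz].
suff : z = 0%R by lia.
nia.
Qed.

(* Multiplying the index by an integer without small prime factors does not
   change u, and every class coprime to k contains such an integer. *)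
Lemma periodic_gcdn l : (0 < l)%N -> u l = u (gcdn l k).
Proof.
move=> l0; have [B uB] := periodic_bounded.
have g0 : (0 < gcdn l k)%N by rewrite gcdn_gt0 l0.
set g := gcdn l k in g0 *.
have /dvdnP[l' ll] : (g %| l)%N := dvdn_gcdl l k.
have /dvdnP[k' kk] : (g %| k)%N := dvdn_gcdr l k.
have cop : coprime l' k'.
  rewrite /coprime -(eqn_pmul2r g0) mul1n muln_gcdl -ll -kk; exact: eqxx.
(* [t] keeps the part of [(2 * B)!] at the primes not dividing [l'], so a prime up to [2 * B]
   divides exactly one of [l'] and [t]. Since [l'] and [k'] are coprime, it cannot divide
   [l' + k' * t]. *)
pose f := (2 * B)`!; pose t := (f`_(\pi(l'))^')%N.
have l'0 : (0 < l')%N by lia.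
have rough q : prime q -> (q %| l' + k' * t)%N -> (2 * B < q)%N.
  move=> q_pr qs; rewrite ltnNge; apply/negP => qB.
  have qf : (q %| f)%N by rewrite dvdn_fact // prime_gt0.
  have qt : (q %| t)%N = ~~ (q %| l')%N.
    have := pi_of_part (\pi(l'))^' (fact_gt0 (2 * B)) q.
    by rewrite !inE /= !mem_primes part_gt0 fact_gt0 q_pr qf l'0.
  case ql: (q %| l')%N qt => /= qt.
    move: qs; rewrite dvdn_addr // Euclid_dvdM // qt orbF => qk.
    have : (q %| gcdn l' k')%N by rewrite dvdn_gcd ql.
    by rewrite (eqP cop) dvdn1; move/eqP=> q1; rewrite q1 in q_pr.
  by move: qs; rewrite dvdn_addl ?ql // dvdn_mull.
have := periodic_rough uB g0 (_ : (0 < l' + k' * t)%N) rough.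
rewrite addn_gt0 l'0 /= => /(_ isT) <-.
by rewrite mulnDl -ll mulnAC -kk periodic_muln.
Qed.
End PeriodicCongruence.

(** * Auxiliary facts on finite sums *)

Lemma sum_nat_ge2 (F : nat -> nat) a b n : a < b -> b < n ->
  F a + F b <= \sum_(0 <= l < n) F l.
Proof.
move=> ab bn; have an := ltn_trans ab bn.
rewrite big_mkord (bigD1 (Ordinal an)) //= (bigD1 (Ordinal bn)) /=.
  by rewrite addnA leq_addr.
by rewrite -val_eqE /= eq_sym (ltn_eqF ab).
Qed.

Lemma eqmodn_dvdz a b q :
  a = b %[mod q] -> (q%:Z %| (a%:Z - b%:Z)%R)%Z.
Proof. by move=> ab; rewrite -eqz_mod_dvd !modz_nat ab. Qed.

Section FiniteSums.
Variable T : finType.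

Lemma sum_excess1 (F : T -> nat) : (forall x, 0 < F x) ->
  \sum_x F x = #|T|.+1 -> exists y, forall x, F x = 1 + (x == y).
Proof.
move=> F0 sF; have : \sum_x (F x).-1 == 1.
  rewrite -(eqn_add2l #|T|) addn1 -sF -sum1_card -big_split /=.
  by apply/eqP/eq_bigr => x _; have := F0 x; lia.
case/sum_nat_eq1 => y [_ Fy Fn]; exists y => x.
have := F0 x; case: eqVneq => [-> | /Fn/(_ isT)]; lia.
Qed.

(** If [f] moved [y], then [y] and [f y] would both contribute. This is how a walk that is unique is
    shown to consist of fixed vertices. *)
Lemma invariant_support (f : T -> T) (F : T -> nat) :
  (forall y, F (f y) = F y) -> \sum_y F y <= 1 ->
  forall y, 0 < F y -> f y = y.
Proof.
move=> Ff F1 y Fy; apply/eqP; apply: contraTT F1 => fy.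
by rewrite (bigD1 y) //= (bigD1 (f y)) //= Ff; lia.
Qed.

Lemma sum_invariant (f : T -> T) (F : T -> nat) :
  (forall y, F (f y) = F y) -> \sum_y F y <= 1 ->
  \sum_(y | f y == y) F y = \sum_y F y.
Proof.
move=> Ff F1; rewrite [RHS](bigID (fun y => f y == y)) /= [X in _ + X]big1 ?addn0 //.
move=> y fy; apply/eqP; rewrite -leqn0 leqNgt; apply: contra fy => Fy.
by rewrite (invariant_support Ff F1 Fy).
Qed.
End FiniteSums.

(** * The repeat automorphism and its fixed subdigraphs *)

Section Moore.
Variables (T : finType) (e : rel T) (d k : nat) (r : T -> T).
Notation nw := (kpow (fun u v => nat_of_bool (e u v))).
Notation S u v := (\sum_(0 <= l < k.+1) nw l u v).
Hypotheses (k_gt2 : 2 < k) (d_gt0 : 0 < d)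
  (outd : forall u, \sum_v nat_of_bool (e u v) = d)
  (ind : forall v, \sum_u nat_of_bool (e u v) = d)
  (SE : forall u v, S u v = 1 + (v == r u))
  (r_inj : injective r).

Lemma two_walks u v a b :
  a < b -> b <= k -> 0 < nw a u v -> 0 < nw b u v -> v = r u.
Proof.
move=> ab bk na nb; apply/eqP.
have := @sum_nat_ge2 (fun l => nw l u v) a b k.+1 ab bk.
by rewrite SE; case: eqP => //; lia.
Qed.

Lemma no_loop u : ~~ e u u.
Proof.
apply/negP => uu; have := SE u u.
have n1 : nw 1 u u = 1 by rewrite kpow1 uu.
have n2 : 0 < nw 2 u u by rewrite -[2]/(1 + 1) (@kpow_gt0D _ _ _ _ _ u) ?n1.
rewrite big_ltn // (big_ltn (_ : 1 < k.+1)); last by lia.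
rewrite (big_ltn (_ : 2 < k.+1)); last by lia.
have n0 : nw 0 u u = 1 by rewrite /= eqxx.
by rewrite n0 n1; case: (u == r u); lia.
Qed.

(** Such a walk makes [u] its own repeat. Followed by an arc from [u] to [w], it gives walks to [w]
    of lengths 1 and [l + 1 <= k], so [w = r u = u], a loop. *)
Lemma no_short_closed_walk l u : 0 < l -> l < k -> nw l u u = 0.
Proof.
move=> l0 lk; apply/eqP; rewrite -leqn0 leqNgt; apply/negP => nl.
have ru : u = r u by apply: (@two_walks u u 0 l) => //=; [exact: ltnW | rewrite eqxx].
have [w uw] : exists w, e u w.
  apply/existsP; rewrite -[[exists _, _]]negbK negb_exists; apply/negP => /forallP eu.
  by move: (outd u) d_gt0; rewrite big1 => [<- // | w _]; rewrite (negPf (eu w)).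
have n1 : 0 < nw 1 u w by rewrite kpow1 uw.
have := @two_walks u w 1 (l + 1) _ _ n1 (kpow_gt0D nl n1).
rewrite -ru addn1 ltnS => /(_ l0 lk) wu.
by move: uw; rewrite wu (negPf (no_loop u)).
Qed.

(** [J + P] is a polynomial in [A], hence commutes with [A]; diregularity gives [A J = J A], so [A]
    commutes with [P]. *)
Lemma repeat_automorphism u v : e (r u) (r v) = e u v.
Proof.
have comm : \sum_w e u w * S w (r v) = \sum_w S u w * e w (r v).
  under eq_bigr do rewrite big_distrr.
  under [RHS]eq_bigr do rewrite big_distrl.
  rewrite exchange_big [RHS]exchange_big /=; apply: eq_bigr => l _.
  by rewrite -kpowSr.
move: comm; under eq_bigr do rewrite SE mulnDr muln1 (inj_eq r_inj) eq_sym.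
under [RHS]eq_bigr do rewrite SE mulnDl mul1n eq_sym.
rewrite !big_split /= outd ind sum_delta sum_deltal => /addnI.
by case: (e u v); case: (e _ _).
Qed.

Lemma iter_repeat_bij p : bijective (iter p r).
Proof.
apply: injF_bij; elim: p => [|p IH] x y //= /r_inj; exact: IH.
Qed.

Lemma iter_repeat_automorphism p u v : e (iter p r u) (iter p r v) = e u v.
Proof. by elim: p => //= p IH; rewrite repeat_automorphism. Qed.

Lemma nw_iter_repeat p l u v : nw l (iter p r u) (iter p r v) = nw l u v.
Proof.
apply: kpow_morph; first exact: iter_repeat_bij.
by move=> *; rewrite iter_repeat_automorphism.
Qed.

Lemma iter_fixed p u : r u = u -> iter p r u = u.
Proof. by move=> ru; elim: p => //= p ->. Qed.


Lemma froot_repeat w : froot r (r w) = froot r w.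
Proof.
by apply/eqP; rewrite eq_sym (root_connect (fconnect_sym r_inj)); exact: fconnect1.
Qed.

Lemma froot_invariant (A : Type) (h : T -> A) :
  (forall w, h (r w) = h w) -> forall w, h (froot r w) = h w.
Proof.
move=> hr w; rewrite -(iter_findex (connect_root (frel r) w)).
by elim: (findex _ _ _) => //= i IH; rewrite hr.
Qed.

Variable z : T.
Hypotheses (rz : r z = z) (closed_z : 0 < nw k z z).

Lemma nw_fixed_le1 l v : l <= k -> nw l z v <= 1.
Proof.
move=> lk; case: (eqVneq v z) => [-> | vz].
  case: (posnP l) => [-> | l0]; first by rewrite /= leq_b1.
  have : nw 0 z z + nw l z z <= S z z by exact: (@sum_nat_ge2 (fun i => nw i z z)).
  by rewrite SE rz [nw 0 z z]/= !eqxx; lia.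
have := SE z v; rewrite rz (negPf vz) addn0 => <-.
by rewrite big_mkord (bigD1 (Ordinal (lk : l < k.+1))) //= leq_addr.
Qed.

(** The closed walk of length [k] at [z] is unique, so [r] maps it to itself; [z1] is its second
    vertex. *)
Lemma fixed_successor : exists2 z1, e z z1 & r z1 = z1.
Proof.
have := closed_z; rewrite -(prednK (_ : 0 < k)); last lia.
rewrite [kpow _ _.+1 _ _]/= => nk.
have [z1 z1P] : exists w, 0 < e z w * nw k.-1 w z.
  apply/existsP; apply: contraTT nk; rewrite negb_exists => /forallP n0.
  by rewrite big1 // => w _; apply/eqP; rewrite -leqn0 leqNgt.
exists z1; first by move: z1P; case: (e z z1).
apply: (invariant_support (F := fun w => e z w * nw k.-1 w z)) z1P.
  move=> y; rewrite -{1}rz repeat_automorphism; congr (_ * _).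
  by rewrite -{1}rz (nw_iter_repeat 1 _ y z).
have := @nw_fixed_le1 k z (leqnn k).
by rewrite -{1}(prednK (_ : 0 < k)) //; lia.
Qed.

Section FixedSubdigraph.
Variable p : nat.
Notation X u := (iter p r u == u).

(* Both sides count the walks of length at most k+1 from u to v whose
   vertices next to u and to v are fixed: every such walk is determined by
   its first step and also by its last one. *)
Lemma fixed_degree_transfer u v : X u -> r v = v -> ~~ e u v ->
  \sum_(w | X w) e u w = \sum_(y | X y) e y v.
Proof.
move=> /eqP Xu rv uv; have Xv := iter_fixed p rv.
pose c w y := e u w * (\sum_(0 <= l < k) nw l w y) * e y v.
have tail w y : \sum_(0 <= l < k) nw l.+1 w y + (w == y) = S w y.
  by rewrite [RHS]big_nat_recl // addnC.
have row w : \sum_y c w y = e u w.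
  rewrite /c; under eq_bigr do rewrite -mulnA big_distrl.
  rewrite -big_distrr exchange_big /=.
  under eq_bigr do rewrite -kpowSr.
  case uw: (e u w); rewrite ?mul0n // mul1n.
  have wv : w == v = false by apply: contraNF uv => /eqP <-.
  by have := tail w v; rewrite SE wv -{2}rv (inj_eq r_inj) eq_sym wv; lia.
have col y : \sum_w c w y = e y v.
  rewrite /c -big_distrl; under eq_bigr do rewrite big_distrr.
  rewrite exchange_big /=.
  case yv: (e y v); rewrite ?muln0 // muln1.
  have uy : u == y = false by apply: contraNF uv => /eqP ->.
  (* An arc from [r u] to [v = r v] would be the image of the excluded arc from [u] to [v]. *)
  have ry : y == r u = false.
    by apply: contraNF uv => /eqP yu; rewrite -repeat_automorphism rv -yu yv.
  rewrite -[LHS]/(\sum_(0 <= l < k) nw l.+1 u y).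
  by have := tail u y; rewrite SE uy ry; lia.
have cinv w y : c (iter p r w) (iter p r y) = c w y.
  rewrite /c -{1}Xu -{1}Xv !iter_repeat_automorphism.
  by under eq_bigr do rewrite nw_iter_repeat.
(* Each row and each column of [c] has sum at most 1 and, at a fixed index, is invariant under
   [iter p r]; restricting the other index to fixed vertices therefore loses nothing. *)
transitivity (\sum_(w | X w) \sum_(y | X y) c w y).
  apply: eq_bigr => w /eqP Xw; rewrite (@sum_invariant _ (iter p r)).
  - by rewrite row.
  - by move=> y; rewrite -{1}Xw cinv.
  - by rewrite row leq_b1.
rewrite exchange_big /=; apply: eq_bigr => y /eqP Xy.
rewrite (@sum_invariant _ (iter p r) (fun w => c w y)).
- by rewrite col.
- by move=> w; rewrite -{1}Xy cinv.
- by rewrite col leq_b1.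
Qed.

Lemma X_repeat u : X (r u) = X u.
Proof. by rewrite -iterSr iterS (inj_eq r_inj). Qed.

Lemma Xz : X z. Proof. by rewrite iter_fixed. Qed.

Definition fixed_degree := \sum_(w | X w) e z w.
Notation c := fixed_degree.

(** The in-degrees of [z] and [z1] inside [X] both equal [c], and the out-degree of [u] is
    transferred to one of them. If [u] had arcs to both, the walks of lengths 1 and 2 to [z1] would
    force [z1 = r u], so [u = z1] would carry a loop. *)
Lemma fixed_regular u : X u -> \sum_(w | X w) e u w = c.
Proof.
have [z1 zz1 rz1] := fixed_successor.
have z1z : ~~ e z1 z.
  apply/negP => z1z; have := @no_short_closed_walk 2 z isT k_gt2.
  have : 0 < nw (1 + 1) z z by apply: (@kpow_gt0D _ _ _ _ _ z1); rewrite kpow1 ?zz1 ?z1z.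
  by move=> + n0; rewrite n0.
have Xz1 : X z1 by rewrite iter_fixed.
have inz : \sum_(y | X y) e y z = c.
  by rewrite -(fixed_degree_transfer Xz rz) // no_loop.
have inz1 : \sum_(y | X y) e y z1 = c.
  rewrite -inz -(fixed_degree_transfer Xz1 rz z1z).
  by rewrite (fixed_degree_transfer Xz1 rz1) // no_loop.
move=> Xu; case uz: (e u z); last by rewrite (fixed_degree_transfer Xu rz) ?uz.
rewrite (fixed_degree_transfer Xu rz1) //; apply/negP => uz1.
have n1 : 0 < nw 1 u z1 by rewrite kpow1 uz1.
have n2 : 0 < nw (1 + 1) u z1.
  by apply: (@kpow_gt0D _ _ _ _ _ z); rewrite kpow1 ?uz ?zz1.
have := two_walks (isT : 1 < 1 + 1) (ltnW k_gt2) n1 n2.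
rewrite -{1}rz1 => /r_inj z1u; move: (no_loop u).
by rewrite -{2}z1u uz1.
Qed.

(** * Walks in the fixed subdigraph and its quotient by the repeat map *)

Notation nwX := (kpow (fun u v => nat_of_bool [&& X u, X v & e u v])).
Notation SX u v := (\sum_(0 <= l < k.+1) nwX l u v).

Lemma leq_nwX l u v : nwX l u v <= nw l u v.
Proof. by apply: leq_kpow => x y; case: (e x y); rewrite ?andbF ?leq_b1. Qed.

Lemma nwX_out l u v : ~~ X u -> nwX l.+1 u v = 0.
Proof. by move=> Xu /=; rewrite big1 // => w _; rewrite (negPf Xu). Qed.

Lemma nwX_in l u v : ~~ X v -> nwX l.+1 u v = 0.
Proof.
by move=> Xv; rewrite kpowSr big1 // => w _; rewrite (negPf Xv) andbF muln0.
Qed.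

Lemma nwX_repeat l u v : nwX l (r u) (r v) = nwX l u v.
Proof.
apply: kpow_morph; first exact: (iter_repeat_bij 1).
by move=> x y; rewrite !X_repeat repeat_automorphism.
Qed.

Lemma nwX_row l u : X u -> \sum_(v | X v) nwX l u v = c ^ l.
Proof.
apply: (@kpow_row_sum _ (fun v => X v)) => [x y /negPf -> | x Xx]; first by rewrite andbF.
by rewrite -(fixed_regular Xx); apply: eq_bigr => y Xy; rewrite Xx Xy.
Qed.

(** A walk of length at most [k] from [z] to a fixed vertex is the only one of its length, so
    [iter p r] fixes all its vertices. *)
Lemma nwX_z l v : l <= k -> X v -> nwX l z v = nw l z v.
Proof.
elim: l v => [|l IH] v lk Xv //.
rewrite !kpowSr; apply: eq_bigr => w _.
case Xw: (X w); first by rewrite IH ?(ltnW lk) // Xv.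
rewrite muln0; case: (posnP (nw l z w * e w v)) => [-> // | nz].
suff : X w by rewrite Xw.
apply/eqP.
apply: (invariant_support (F := fun x => nw l z x * e x v)) nz => [x|].
  rewrite -{1}(eqP Xz) -{1}(eqP Xv).
  by rewrite nw_iter_repeat iter_repeat_automorphism.
by rewrite -kpowSr nw_fixed_le1.
Qed.

Lemma sum_fixed_S u : X u ->
  \sum_(v | X v) (1 + (v == r u)) = (\sum_(v | X v) 1).+1.
Proof.
move=> Xu; rewrite big_split /= -[RHS]addn1; congr (_ + _).
rewrite (bigD1 (r u)) ?X_repeat //= eqxx big1 // => v /andP[_ /negPf-> //].
Qed.

Lemma sum_SX u : X u -> \sum_(v | X v) SX u v = \sum_(0 <= l < k.+1) c ^ l.
Proof.
by move=> Xu; rewrite exchange_big /=; apply: eq_bigr => l _; rewrite nwX_row.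
Qed.

(** Read off in the row of [z], where both walk counts agree; the extra 1 is the second walk from
    [z] to itself. *)
Lemma card_fixed : (\sum_(v | X v) 1).+1 = \sum_(0 <= l < k.+1) c ^ l.
Proof.
rewrite -(sum_SX Xz) -(sum_fixed_S Xz); apply: eq_bigr => v Xv.
rewrite -SE [RHS]big_nat [LHS]big_nat; apply: eq_bigr => l /andP[_ lk].
by rewrite nwX_z.
Qed.

(** [SX] is at most [S] entrywise, and by [card_fixed] their row sums over the fixed vertices
    agree. *)
Lemma SXE u v : X u -> X v -> SX u v = 1 + (v == r u).
Proof.
move=> Xu Xv; rewrite -SE.
have leS w : SX u w <= S u w by apply: leq_sum => l _; apply: leq_nwX.
have := sum_SX Xu; rewrite -card_fixed -(sum_fixed_S Xu).
under [RHS]eq_bigr do rewrite -SE.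
rewrite (bigD1 v) //= [RHS](bigD1 v) //= => E.
have : \sum_(w | X w && (w != v)) SX u w <= \sum_(w | X w && (w != v)) S u w.
  by apply: leq_sum => w _.
by have := leS v; lia.
Qed.

(* Adjacency matrix of the quotient of the fixed subdigraph by r, each orbit
   being represented by its froot; the rows of the other vertices are copies,
   which does not change the traces of the powers. *)
Definition orbit_kernel u v := \sum_w [&& X u, X w & e u w] * (froot r w == v).
Notation tau l := (\sum_u kpow orbit_kernel l u u).

(** Since [r] preserves walk counts, walks into a given orbit can be counted from [w] instead of
    [froot r w]. The exponent is positive: at 0 the right side would be [froot r u == v]. *)
Lemma orbit_kernel_pow l u v :
  kpow orbit_kernel l.+1 u v = \sum_w nwX l.+1 u w * (froot r w == v).
Proof.
elim: l u v => [|l IH] u v.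
  by rewrite kpow1; apply: eq_bigr => w _; rewrite kpow1.
pose h x := \sum_y nwX l.+1 x y * (froot r y == v).
have hr x : h (r x) = h x.
  rewrite /h (reindex r); last by apply: onW_bij; exact: (iter_repeat_bij 1).
  by apply: eq_bigr => y _; rewrite froot_repeat nwX_repeat.
transitivity (\sum_w [&& X u, X w & e u w] * h w).
  rewrite [LHS]/= -/(kpow _ l.+1).
  transitivity (\sum_x \sum_w [&& X u, X w & e u w] * (froot r w == x) * h x).
    apply: eq_bigr => x _; rewrite -big_distrl; congr (_ * _); exact: IH.
  rewrite exchange_big; apply: eq_bigr => w _ /=.
  under eq_bigr do rewrite -mulnA.
  by rewrite -big_distrr sum_deltal froot_invariant.
rewrite /h; under eq_bigr do rewrite big_distrr.
rewrite exchange_big; apply: eq_bigr => y _ /=.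
by rewrite big_distrl; apply: eq_bigr => w _; rewrite mulnA.
Qed.

(** This is [SXE] summed over an orbit: [x] and [r x] share an orbit, so the missing walk of length
    0 cancels the excess at [r x]. *)
Lemma orbit_window x u : X x ->
  \sum_(w | X w) (\sum_(0 <= l < k) nwX l.+1 x w) * (froot r w == u) =
  \sum_(w | X w) (froot r w == u).
Proof.
move=> Xx; apply: (@addnI (froot r x == u)).
have delta y : X y -> \sum_(w | X w) (w == y) * (froot r w == u) = (froot r y == u).
  move=> Xy; rewrite (bigD1 y) //= eqxx mul1n big1 ?addn0 //.
  by move=> w /andP[_ /negPf->].
rewrite -{1}(delta x) // -big_split -[in RHS]froot_repeat -(delta (r x)) ?X_repeat //.
rewrite -big_split /=; apply: eq_bigr => w Xw.
have := SXE Xx Xw; rewrite big_nat_recl //= eq_sym -mulnDl => ->.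
by rewrite mulnDl mul1n addnC.
Qed.

(** Walks are cut after [m] steps at a vertex [x]. By [orbit_window] the remaining steps contribute
    the orbit size [h u], whatever [x] is, and the first [m] steps contribute [c ^ m]. *)
Lemma trace_window m :
  \sum_(0 <= l < k) tau (m + l.+1) = c ^ m * \sum_(v | X v) 1.
Proof.
pose h u := \sum_(w | X w) (froot r w == u).
transitivity (\sum_u (\sum_(x | X x) nwX m u x) * h u).
  rewrite exchange_big /=; apply: eq_bigr => u _.
  transitivity (\sum_(0 <= l < k) \sum_(w | X w) \sum_(x | X x)
                 nwX m u x * (nwX l.+1 x w * (froot r w == u))).
    apply: eq_bigr => l _; rewrite addnS orbit_kernel_pow -addnS.
    rewrite (bigID (fun w => X w)) /= [Y in _ + Y]big1 ?addn0; last first.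
      by move=> w Xw; rewrite addnS nwX_in.
    apply: eq_bigr => w _; rewrite kpowD big_distrl /=.
    rewrite (bigID (fun x => X x)) /= [Y in _ + Y]big1 ?addn0; last first.
      by move=> x Xx; rewrite -/(kpow _ l.+1 _ _) nwX_out // muln0.
    by apply: eq_bigr => x _; rewrite mulnA.
  rewrite exchange_big big_distrl /=.
  under eq_bigr do rewrite exchange_big.
  rewrite exchange_big /=; apply: eq_bigr => x Xx.
  rewrite -[h u](orbit_window u Xx) big_distrr /=; apply: eq_bigr => w _.
  by rewrite big_distrl big_distrr.
transitivity (\sum_u c ^ m * h u).
  apply: eq_bigr => u _; case Xu : (X u); first by rewrite nwX_row.
  suff -> : h u = 0 by rewrite !muln0.
  rewrite /h big1 // => w Xw; case: eqP => // wu.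
  by move: Xu; rewrite -wu (froot_invariant (h := fun x => X x)) ?Xw // => x; apply: X_repeat.
rewrite -big_distrr /h exchange_big /=; congr (_ * _).
apply: eq_bigr => w _; rewrite (bigD1 (froot r w)) //= eqxx big1 // => u.
by rewrite eq_sym => /negPf->.
Qed.

(** A nonzero term is a walk of length [l] from [u] to some [iter j r u]. Chaining its [p]
    successive images under [iter j r] closes up at [u] with length [l * p <= k], so [r u = u]; then
    the first walk is itself closed and shorter than [k]. *)
Lemma trace_zero l : 0 < p -> 0 < l -> l < k -> l * p <= k -> tau l = 0.
Proof.
case: l => // l p0 _ lk lpk; rewrite big1 // => u _.
rewrite orbit_kernel_pow big1 // => w _; case: eqP => [wu | _]; last by rewrite muln0.
rewrite muln1; apply/eqP; rewrite -leqn0 leqNgt; apply/negP => nl.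
have Xu : X u by apply: contraTT nl => Xu; rewrite nwX_out.
have {}nl := leq_trans nl (leq_nwX _ _ _).
have uw : fconnect r u w.
  by rewrite (fconnect_sym r_inj) -wu; exact: connect_root.
move: nl; rewrite -(iter_findex uw); set j := findex _ _ _ => nl.
have nli i : 0 < nw (i * l.+1) u (iter (i * j) r u).
  elim: i => [|i IH]; first by rewrite /= eqxx.
  rewrite mulSn; apply: (kpow_gt0D nl).
  by rewrite mulSn iterD nw_iter_repeat.
have fix_j : iter (p * j) r u = u.
  by elim: (j) => [|i IH]; rewrite ?muln0 // mulnS iterD IH (eqP Xu).
have := nli p; rewrite fix_j mulnC => np.
have ru : r u = u.
  by apply/esym/(@two_walks u u 0 (l.+1 * p)) => //=; rewrite ?muln_gt0 ?p0 ?eqxx.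
by move: nl; rewrite iter_fixed // no_short_closed_walk.
Qed.

Lemma trace_periodic_gcdn l : 0 < l ->
  ((tau l)%:Z - (c ^ l)%:Z = (tau (gcdn l k))%:Z - (c ^ gcdn l k)%:Z)%R.
Proof.
pose f m := ((tau m)%:Z - (c ^ m)%:Z)%R.
have win m : (\sum_(0 <= i < k) f (m + i.+1)%N = 0)%R.
  rewrite /f sumrB; apply/eqP; rewrite subr_eq0; apply/eqP.
  rewrite -!(big_morph Posz PoszD (erefl 0%R)) trace_window; congr Posz.
  have := card_fixed; rewrite big_nat_recl //= expn0 add1n => -[->].
  by rewrite big_distrr /=; apply: eq_bigr => i _; rewrite -expnD.
apply: (@periodic_gcdn f k) => [|m m0|q m q_pr m0]; first lia.
  case: m m0 => // m _.
  (* Removing either end of [k + 1] consecutive values leaves a window of sum 0, so the first and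
     last values agree. *)
  have : (\sum_(0 <= i < k.+1) f (m + i.+1)%N = f m.+1)%R.
    rewrite big_nat_recl // addn1 -[RHS]addr0; congr (_ + _)%R.
    by rewrite -[RHS](win m.+1); apply: eq_bigr => i _; rewrite addnS.
  by rewrite big_nat_recr //= win add0r addnS addSn.
have E : (f (q * m)%N - f m = ((tau (q * m))%:Z - (tau m)%:Z) -
    ((c ^ (q * m))%:Z - (c ^ m)%:Z))%R by rewrite /f; lia.
rewrite E; apply: rpredB; apply: eqmodn_dvdz; first exact: trace_kpow_prime.
by rewrite mulnC expnM; exact: fermat_little.
Qed.

(** The gcd of [l] and [k] obeys the same bounds as [l], so both traces vanish and the powers of [c]
    must have equal exponents. *)
Lemma short_dvd l : 0 < p -> 1 < c -> 0 < l -> l < k -> l * p <= k -> l %| k.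
Proof.
move=> p0 c1 l0 lk lpk; have := trace_periodic_gcdn l0.
have gl : gcdn l k <= l by apply: dvdn_leq => //; exact: dvdn_gcdl.
have g0 : 0 < gcdn l k by rewrite gcdn_gt0 l0.
rewrite !trace_zero //; [|lia|nia] => E.
have /eqP : c ^ l = c ^ gcdn l k by lia.
by rewrite eqn_exp2l // => /eqP ->; exact: dvdn_gcdr.
Qed.
End FixedSubdigraph.

(** * A short period and the numerical contradiction *)

Lemma fixed_degree1 : fixed_degree 1 <= 1.
Proof.
rewrite leqNgt; apply/negP => c1.
have := @short_dvd 1 k.-1 isT c1; rewrite muln1.
have : ~~ (k.-1 %| k).
  rewrite -{2}(prednK (_ : 0 < k)); last lia.
  by rewrite -addn1 dvdn_addr // dvdn1; lia.
by move=> /negP nk kk; apply: nk; apply: kk; lia.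
Qed.

(** The orbit of a non-fixed out-neighbour [u] of [z] stays among the out-neighbours of [z] and
    avoids [z1], which bounds its size [p]. Both [u] and [z1] are fixed by [iter p r]. *)
Lemma short_period : 1 < d -> exists p,
  [/\ 1 < p, p <= d - 1 & 1 < fixed_degree p].
Proof.
move=> d_gt1; have [z1 zz1 rz1] := fixed_successor.
have [u zu ru] : exists2 u, e z u & r u != u.
  apply/exists_inP; apply: contraTT fixed_degree1 => /exists_inPn nr.
  rewrite -ltnNge /fixed_degree big_mkcond /= (leq_trans d_gt1) // -(outd z).
  apply: leq_sum => w _; case zw: (e z w) => //.
  by have := nr w zw; rewrite negbK => ->.
have uz1 : u != z1 by apply: contraNneq ru => ->; rewrite rz1.
exists (order r u); split.
- have := iter_order r_inj u; have := order_gt0 r u.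
  case: (order r u) => [|[|m]] //= _ ru'.
  by rewrite ru' eqxx in ru.
- have -> : d - 1 = #|[pred w | e z w & w != z1]|.
    rewrite -(outd z) (bigD1 z1) //= zz1 addKn -sum1_card big_mkcond [RHS]big_mkcond /=.
    by apply: eq_bigr => w _; rewrite inE; case: (e z w); case: (w != z1).
  apply: subset_leq_card; apply/subsetP => w.
  rewrite -[w \in _]/(fconnect r u w) => uw.
  rewrite !inE -(iter_findex uw) -{1}(iter_fixed (findex r u w) rz).
  rewrite iter_repeat_automorphism zu /=.
  rewrite -(iter_fixed (findex r u w) rz1).
  by rewrite (bij_eq (iter_repeat_bij _)).
rewrite /fixed_degree (bigD1 z1) ?iter_fixed //= (bigD1 u) /=.
  by rewrite zz1 zu.
by rewrite (iter_order r_inj) eqxx.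
Qed.

Lemma self_repeat_small_diameter : 1 < d ->
  ~ ((odd k /\ 2 * (d - 1) <= k) \/ (~~ odd k /\ 2 * (d - 1) ^ 2 <= k)).
Proof.
move=> d_gt1; have [p [p1 pd cp]] := short_period d_gt1.
have dvd l : 0 < l -> l < k -> l * p <= k -> l %| k.
  by apply: short_dvd => //; exact: ltnW.
case=> [] [ok dk].
  have : 2 %| k by apply: dvd => //; nia.
  by rewrite dvdn2 ok.
pose L := k %/ p.
have LpK : L * p <= k := leq_divM k p.
have kL : k < L.+1 * p by apply: ltn_ceil; lia.
have dL : 2 * (d - 1) <= L by rewrite leq_divRL; [nia | lia].
have Lk : L < k by nia.
have d1 : L %| k by apply: dvd => //; lia.
have d2 : L.-1 %| k by apply: dvd; nia.
(* Consecutive integers are coprime. Then [L * (L - 1) <= k < (L + 1) * p], while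
   [2 * p <= 2 * (d - 1) <= L], which is impossible as [L >= 4]. *)
have : L * L.-1 %| k.
  rewrite Gauss_dvd ?d1 //.
  by rewrite -{1}(prednK (_ : 0 < L)) ?coprimeSn //; lia.
move/(dvdn_leq (_ : 0 < k)); move=> /(_ (ltnW (ltnW k_gt2))).
nia.
Qed.
End Moore.

(** * From digraphs to walk-counting kernels *)

Lemma sum_bool_card (T : finType) (P : pred T) :
  \sum_x nat_of_bool (P x) = #|[set x | P x]|.
Proof.
by rewrite -sum1dep_card [RHS]big_mkcond; apply: eq_bigr => x _; case: (P x).
Qed.

Lemma num_walksE (T : finType) (e : rel T) l u v :
  num_walks e l u v = kpow (fun x y => nat_of_bool (e x y)) l u v.
Proof.
rewrite /num_walks -sum_bool_card; elim: l u => [|l IH] u /=.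
  rewrite (big_pred1 [tuple]) /walk //= => t; apply/esym/eqP; exact: tuple0.
pose f (x : T * l.-tuple T) : l.+1.-tuple T := [tuple of x.1 :: x.2].
rewrite (reindex f) /=; last first.
  apply: onW_bij; exists (fun t => (thead t, [tuple of behead t])) => [[x t] | t].
    by congr (_, _); apply: val_inj.
  by case/tupleP: t => x t; apply: val_inj.
rewrite -(pair_bigA _ (fun x t => nat_of_bool (walk e u v (f (x, t))))) /=.
apply: eq_bigr => w _; rewrite -IH big_distrr /=; apply: eq_bigr => t _.
by rewrite /walk /= -andbA mulnb.
Qed.

Theorem theorem3 (d k : nat) (hd : 6 <= d) (hk : 1 < k)
  (h : (odd k /\ 2 * (d - 1) <= k) \/ (~~ odd k /\ 2 * (d - 1) ^ 2 <= k)) :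
  ~ exists (T : finType) (e : rel T),
      almost_moore e d k /\ has_self_repeats e k.
Proof.
case=> T [e [[_ _ reg [diam _] cardT] [z [Szz nkz]]]].
have k_gt2 : 2 < k by case: h => [] [_]; nia.
pose nw := kpow (fun x y => nat_of_bool (e x y)).
pose S u v := \sum_(0 <= l < k.+1) nw l u v.
have outd u : \sum_v nat_of_bool (e u v) = d by rewrite sum_bool_card; case: (reg u).
have ind v : \sum_u nat_of_bool (e u v) = d.
  by rewrite (sum_bool_card (fun u => e u v)); case: (reg v).
have S_gt0 u v : 0 < S u v.
  have [l [[t ut] _] lk] := diam u v.
  rewrite /S big_mkord (bigD1 (Ordinal (lk : l < k.+1))) //= addn_gt0.
  rewrite /nw -num_walksE; apply/orP; left; apply/card_gt0P.
  by exists t; rewrite inE.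
have sumd : \sum_(0 <= l < k.+1) d ^ l = #|T|.+1.
  by rewrite big_ltn // expn0 cardT.
(* The entries of a row are positive by the diameter and sum to [#|T| + 1], so exactly one entry is
   2. *)
have [r SE] : exists r : T -> T, forall u v, S u v = 1 + (v == r u).
  apply: (@fin_all_exists T (fun=> T) (fun u y => forall v, S u v = 1 + (v == y))).
  move=> u; apply: sum_excess1 => //.
  rewrite -sumd exchange_big /=; apply: eq_bigr => l _.
  by apply: (@kpow_row_sum _ predT _ d) => // x; exact: outd.
have colE l v : \sum_u nw l u v = d ^ l.
  elim: l v => [|l IH] v.
    by under eq_bigr do rewrite -[nw _ _ _]mul1n; exact: (sum_delta (fun=> 1)).
  under eq_bigr do rewrite /nw kpowSr.
  rewrite exchange_big /= expnSr -[Y in _ * Y](ind v) big_distrr /=.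
  by apply: eq_bigr => w _; rewrite -big_distrl /= IH.
(* Columns have the same sum as rows, so column [r u] also has a single entry 2, found in rows [u]
   and [u'] alike. *)
have r_inj : injective r.
  move=> u u' ruu'.
  have [||y Sy] := @sum_excess1 _ (fun x => S x (r u)) => //.
    by rewrite -sumd exchange_big /=; apply: eq_bigr => l _; exact: colE.
  have := Sy u; rewrite SE eqxx; case: eqP => // uy _.
  by have := Sy u'; rewrite SE ruu' eqxx; case: eqP => // u'y _; rewrite uy u'y.
have rz : r z = z.
  have : S z z = 2 by rewrite -Szz; apply: eq_bigr => l _; rewrite num_walksE.
  by rewrite SE; case: eqP.
rewrite num_walksE in nkz.
have d_gt1 : 1 < d by lia.
exact: (@self_repeat_small_diameter T e d k r k_gt2 (ltnW d_gt1) outd ind SE r_inj z rz nkz d_gt1 h).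
Qed.
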